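(* Let $h\colon(0,\infty)\to\mathbb{R}$ be a concave monotone (nondecreasing) function such that $\lim_{x\to\infty}h(x)\,x^{-1}=0$, and suppose that its Legendre transform $$\check h(t)=\inf_{x>0}\bigl(tx-h(x)\bigr)\qquad(t>0)$$ satisfies $$\check h\Bigl(\frac{x+y}{2}\Bigr)\ \ge\ \frac{\check h(x)+\check h(y)}{2}\ \ge\ \check h\Bigl(\frac{2}{x^{-1}+y^{-1}}\Bigr)\qquad\text{for all }x,y>0.$$ Let $f,g\colon(0,\infty)\to(0,\infty)$ be positive operator monotone functions, and let $\Phi\colon M_m(\mathbb{C})\to M_k(\mathbb{C})$ and $\Psi\colon M_n(\mathbb{C})\to M_k(\mathbb{C})$ be strictly positive linear maps. Then the map $$M_m(\mathbb{C})^{++}\times M_n(\mathbb{C})^{++}\to\mathbb{R},\qquad (A,B)\mapsto \operatorname{Tr} h\bigl(\Phi(f(A))^{1/2}\,\Psi(g(B))\,\Phi(f(A))^{1/2}\bigr)$$ is jointly concave.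
   Context: $M_n(\mathbb{C})^{++}$ denotes the set of positive invertible (positive definite) $n\times n$ complex matrices. A linear map $\Phi\colon M_m(\mathbb{C})\to M_k(\mathbb{C})$ is strictly positive if it sends $M_m(\mathbb{C})^{++}$ into $M_k(\mathbb{C})^{++}$. Functions of matrices are defined by functional calculus. A function $f\colon(0,\infty)\to\mathbb{R}$ is operator monotone if for every $n$ and all $A,B\in M_n(\mathbb{C})^{++}$, $A\le B$ implies $f(A)\le f(B)$. Here $A \le B$ is the usual (Loewner) order: $B-A$ is positive semidefinite. Jointly concave means concave as a function of the pair $(A,B)$ on the convex set $M_m(\mathbb{C})^{++}\times M_n(\mathbb{C})^{++}$. $\operatorname{Tr}$ is the usual matrix trace. *)

(* Defs.v *)
From mathcomp Require Import all_boot all_order all_algebra.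
From mathcomp Require Import complex.
From mathcomp Require Import all_classical all_reals all_analysis.

Set Implicit Arguments.
Unset Strict Implicit.
Unset Printing Implicit Defensive.

Import Order.TTheory GRing.Theory Num.Theory.
Import numFieldNormedType.Exports.

Local Open Scope ring_scope.
Local Open Scope complex_scope.
Local Open Scope sesquilinear_scope.
Local Open Scope classical_set_scope.

(* A function (0, oo) -> R is encoded as a total function [R -> R]; its values
   outside `]0, +oo[ are never used. *)

Definition concave_function (R : realType) (D : set R) (h : R -> R) : Prop :=
  @convex_function R R^o D (fun x => - h x).

(* [inf] is real-valued and total.  It is the genuine infimum whenever the set
   is bounded below, which is the case for every t > 0 when h is nondecreasing
   and concave with h x / x --> 0 at +oo. *)
Definition legendre (R : realType) (h : R -> R) (t : R) : R :=
  inf [set t * x - h x | x in `]0, +oo[].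

Section Matrices.
Variable R : realType.
Local Notation C := R[i].

(* The order of R[i] makes [0 <= z] mean that z is real and nonnegative. *)
Definition psdmx n (A : 'M[C]_n) : Prop :=
  A \is hermsymmx /\ forall v : 'rV[C]_n, 0 <= (v *m A *m v ^t*) 0 0.

Definition pdmx n (A : 'M[C]_n) : Prop := psdmx A /\ A \in unitmx.

Definition loewner_le n (A B : 'M[C]_n) : Prop := psdmx (B - A).

(* Functional calculus, meaningful for Hermitian A: by [orthomx_spectralP],
   A = invmx P *m diag_mx d *m P with P unitary, and d is real by
   [hermitian_spectral_diag_real], so taking real parts loses nothing. *)
Definition mxfun n (f : R -> R) (A : 'M[C]_n) : 'M[C]_n :=
  invmx (spectralmx A)
    *m diag_mx (map_mx (fun z => (f (complex.Re z))%:C) (spectral_diag A))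
    *m spectralmx A.

Definition sqrtmx n (A : 'M[C]_n) : 'M[C]_n := mxfun (@Num.sqrt R) A.

Lemma Im_mxtrace_mxfun n (f : R -> R) (A : 'M[C]_n) :
  complex.Im (\tr (mxfun f A)) = 0.
Proof.
rewrite /mxfun mxtrace_mulC mulKVmx ?spectral_unit// mxtrace_diag.
by rewrite (raddf_sum (@complex.Im R)) big1// => i _; rewrite mxE.
Qed.

(* The trace of [mxfun h A] is real by [Im_mxtrace_mxfun]. *)
Definition trfun n (h : R -> R) (A : 'M[C]_n) : R :=
  complex.Re (\tr (mxfun h A)).

Definition operator_monotone (f : R -> R) : Prop :=
  forall n (A B : 'M[C]_n), pdmx A -> pdmx B ->
    loewner_le A B -> loewner_le (mxfun f A) (mxfun f B).

Definition strictly_positive m k (Phi : 'M[C]_m -> 'M[C]_k) : Prop :=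
  forall A, pdmx A -> pdmx (Phi A).

Definition jointly_concave m n (F : 'M[C]_m -> 'M[C]_n -> R) : Prop :=
  forall (A1 A2 : 'M[C]_m) (B1 B2 : 'M[C]_n) (t : R),
    pdmx A1 -> pdmx A2 -> pdmx B1 -> pdmx B2 -> 0 <= t <= 1 ->
    t * F A1 B1 + (1 - t) * F A2 B2
      <= F (t%:C *: A1 + (1 - t)%:C *: A2) (t%:C *: B1 + (1 - t)%:C *: B2).

End Matrices.

(* Main.v *)
Require Import Defs.
From mathcomp Require Import all_boot all_order all_algebra.
From mathcomp Require Import complex.
From mathcomp Require Import all_classical all_reals all_analysis.
From mathcomp Require Import ring lra.

Set Implicit Arguments.
Unset Strict Implicit.
Unset Printing Implicit Defensive.

Import Order.TTheory GRing.Theory Num.Theory.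
Import numFieldNormedType.Exports.

Local Open Scope ring_scope.
Local Open Scope complex_scope.
Local Open Scope classical_set_scope.

(* Write [phi u] for minus the Legendre transform of [h] at [1 / u].  The second
   Legendre hypothesis makes [phi] midpoint concave, hence concave since it is
   nondecreasing.  Legendre duality gives
     Tr h (X^(1/2) Y X^(1/2)) = inf_G Tr ((G G')^-1 Y) + Tr phi (G' X G)
   over invertible [G], with [G'] the adjoint of [G].  Each expression under the
   infimum is jointly concave and nondecreasing in [(X, Y)], hence so is the
   infimum.  Positive operator monotone functions are operator concave, so
   [X = Phi (f A)] and [Y = Psi (g B)] are concave in [A] and [B]. *)

(** The obstacle is that [X^(1/2)] does not depend on [X] in a way that can be compared term by
    term. Duality applied directly to [Z = X^(1/2) Y X^(1/2)] gives [Tr (Q^-1 Z) + Tr phi Q], which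
    still contains the root. Parametrising [Q = (X^(1/2) G) (X^(1/2) G)'] cancels it: the first term
    becomes linear in [Y] alone, and [Q] is similar to [G' X G], which is linear in [X]. The infimum
    need not be attained, because a supergradient of [h] may vanish, so a slack [e] is carried to
    the end. Operator concavity is obtained without first proving [f] continuous: it is shown up to
    a dilation by [1 + d], and the same inequality, applied to multiples of one matrix, bounds the
    effect of that dilation. Eigenbases enter through an arbitrary choice made by [spectralmx];
    intertwining relations make the results independent of it. *)

(** * Concave functions on the open half-line *)

Section ScalarConcavity.
Variable R : realType.
Implicit Types (h f : R -> R) (x y z t : R).

Lemma conv_gt0 x y t : 0 < x -> 0 < y -> 0 <= t <= 1 ->
  0 < t * x + (1 - t) * y.
Proof.
move=> x0 y0 /andP[t0 t1]; case: (lerP t (1 / 2)) => t2.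
  by apply: ltr_wpDl; [apply: mulr_ge0; lra | apply: mulr_gt0; lra].
by apply: ltr_wpDr; [apply: mulr_ge0; lra | apply: mulr_gt0; lra].
Qed.

Definition concave_pos f : Prop := forall x y t, 0 < x -> 0 < y ->
  0 <= t <= 1 -> t * f x + (1 - t) * f y <= f (t * x + (1 - t) * y).

Lemma concave_function_pos h : concave_function `]0, +oo[ h -> concave_pos h.
Proof.
move=> hc x y t x0 y0 t01.
have xD : x \in (`]0, +oo[%classic : set R) by rewrite inE /= in_itv/= x0.
have yD : y \in (`]0, +oo[%classic : set R) by rewrite inE /= in_itv/= y0.
have := hc (Itv01 (proj1 (andP t01)) (proj2 (andP t01))) x y xD yD.
rewrite /conv /= /conv /= /unstable.onem /GRing.scale/=; lra.
Qed.

Lemma concave_slopes f x y z : concave_pos f -> 0 < x -> x < z -> z < y ->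
  (f y - f z) / (y - z) <= (f z - f x) / (z - x).
Proof.
move=> fc x0 xz zy.
have yx : 0 < y - x by lra.
have t01 : 0 <= (y - z) / (y - x) <= 1.
  by rewrite divr_ge0 ?ler_pdivrMr//; lra.
have := fc x y _ x0 (lt_trans (lt_trans x0 xz) zy) t01.
have -> : (y - z) / (y - x) * x + (1 - (y - z) / (y - x)) * y = z.
  by field; rewrite gt_eqF.
have -> : (y - z) / (y - x) * f x + (1 - (y - z) / (y - x)) * f y =
    ((y - z) * f x + (z - x) * f y) / (y - x).
  by field; rewrite gt_eqF.
rewrite ler_pdivrMr// => le_z.
rewrite ler_pdivrMr ?subr_gt0// mulrAC ler_pdivlMr ?subr_gt0//; lra.
Qed.

(** The slope [c] is the supremum of the slopes to the right of [z]. Every slope to the left of [z]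
    is an upper bound of these, which settles the points [x < z]; the slope from [z / 2] shows that
    the supremum is finite. *)
Lemma concave_supergradient f z : concave_pos f -> 0 < z ->
  exists c, forall x, 0 < x -> f x <= f z + c * (x - z).
Proof.
move=> fc z0.
pose S := [set (f x - f z) / (x - z) | x in `]z, +oo[%classic].
have ubS x : 0 < x -> x < z -> ubound S ((f z - f x) / (z - x)).
  move=> x0 xz s [y /=]; rewrite in_itv/= andbT => zy <-.
  exact: concave_slopes.
have S0 : S !=set0.
  exists ((f (z + 1) - f z) / (z + 1 - z)), (z + 1) => //=.
  by rewrite in_itv/= andbT; lra.
exists (sup S) => x x0; have [xz|zx|->] := ltgtP x z; last by lra.
- have := ge_sup S0 (ubS x x0 xz).
  by rewrite ler_pdivlMr ?subr_gt0//; lra.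
- have : (f x - f z) / (x - z) <= sup S.
    apply: ub_le_sup; last by exists x => //=; rewrite in_itv/= andbT.
    by exists ((f z - f (z / 2)) / (z - z / 2)); apply: ubS; lra.
  by rewrite ler_pdivrMr ?subr_gt0//; lra.
Qed.

(* Subtracting the chord leaves a midpoint-concave function on [0, 1] that
   vanishes at the end points; halving towards the nearer end point halves any
   lower bound. *)
Lemma midpoint_concave_pos f :
  (forall x y, 0 < x -> x <= y -> f x <= f y) ->
  (forall x y, 0 < x -> 0 < y -> (f x + f y) / 2 <= f ((x + y) / 2)) ->
  concave_pos f.
Proof.
move=> f_nd f_mid x y t x0 y0 t01.
pose u s := f (s * x + (1 - s) * y) - (s * f x + (1 - s) * f y).
have pos s : 0 <= s <= 1 -> 0 < s * x + (1 - s) * y by exact: conv_gt0.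
have u_mid a b : 0 <= a <= 1 -> 0 <= b <= 1 -> (u a + u b) / 2 <= u ((a + b) / 2).
  move=> a01 b01; rewrite /u.
  have := f_mid _ _ (pos a a01) (pos b b01).
  have -> : (a * x + (1 - a) * y + (b * x + (1 - b) * y)) / 2 =
      (a + b) / 2 * x + (1 - (a + b) / 2) * y by field.
  lra.
have u0 : u 0 = 0 by rewrite /u !mul0r subr0 !mul1r !add0r subrr.
have u1 : u 1 = 0 by rewrite /u subrr !mul0r !mul1r !addr0 subrr.
(* Monotonicity supplies the regularity: on the whole segment [f] is at least its value at the
   smaller end point. *)
have [M M0 uM] : exists2 M, 0 <= M & forall s, 0 <= s <= 1 -> - M <= u s.
  pose a := f (Num.min x y); pose b := `|f x| + `|f y|.
  exists (`|a| + b) => [|s s01]; first by rewrite !addr_ge0.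
  have m0 : 0 < Num.min x y by rewrite lt_min x0.
  have : Num.min x y <= s * x + (1 - s) * y.
    set m := Num.min x y.
    have mx : m <= x by rewrite ge_min lexx.
    have my : m <= y by rewrite ge_min lexx orbT.
    have /andP[s0 s1] := s01; rewrite -subr_ge0.
    have -> : s * x + (1 - s) * y - m = s * (x - m) + (1 - s) * (y - m) by ring.
    by apply: addr_ge0; apply: mulr_ge0; lra.
  move/(f_nd _ _ m0) => fm; rewrite /u.
  have /andP[s0 s1] := s01.
  have sx : s * f x <= `|f x|.
    apply: (le_trans (ler_norm _)); rewrite normrM (ger0_norm s0).
    by rewrite -[leRHS]mul1r ler_wpM2r.
  have sy : (1 - s) * f y <= `|f y|.
    apply: (le_trans (ler_norm _)); rewrite normrM ger0_norm ?subr_ge0//.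
    by rewrite -[leRHS]mul1r ler_wpM2r//; lra.
  have : - `|a| <= a by rewrite lerNl -normrN ler_norm.
  by rewrite /b; move: fm; rewrite -/a; lra.
have uMn n s : 0 <= s <= 1 -> - (M / 2 ^+ n) <= u s.
  elim: n s => [|n IHn] s s01; first by rewrite expr0 divr1 uM.
  rewrite exprS invfM mulrCA.
  case: (lerP s (1 / 2)) => s2.
    have s2' : 0 <= s + s <= 1 by lra.
    have z01 : 0 <= (0 : R) <= 1 by lra.
    have := u_mid _ _ z01 s2'; rewrite u0 add0r.
    have -> : (0 + (s + s)) / 2 = s by field.
    by have := IHn _ s2'; lra.
  have s2' : 0 <= s + s - 1 <= 1 by lra.
  have o01 : 0 <= (1 : R) <= 1 by lra.
  have := u_mid _ _ o01 s2'; rewrite u1 add0r.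
  have -> : (1 + (s + s - 1)) / 2 = s by field.
  by have := IHn _ s2'; lra.
rewrite -subr_ge0 -/(u t) leNgt; apply/negP => ut0.
(* Since [n < 2 ^ n], this [n] makes [- (M / 2 ^ n)] larger than the negative value [u t]. *)
have [n Mn] : exists n : nat, M / - u t < n%:R.
  by exists (Num.truncn (M / - u t)).+1; rewrite truncnS_gt.
have := uMn n _ t01; rewrite lerNl ler_pdivlMr ?exprn_gt0// leNgt => /negP; apply.
move: Mn; rewrite ltr_pdivrMr ?oppr_gt0// => /lt_le_trans; apply.
rewrite mulrC; apply: ler_wpM2l; first by lra.
by rewrite -natrX ler_nat ltnW// ltn_expl.
Qed.

(** * The Legendre transform and scalar duality *)

Section Legendre.
Variable h : R -> R.
Hypothesis h_nd : forall x y, 0 < x -> x <= y -> h x <= h y.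
Hypothesis h_sublinear : h x * x^-1 @[x --> +oo] --> (0 : R).

(** Makes [inf] a genuine infimum. Sublinearity gives [h x < t * x] beyond some [N], and on []0, N]]
    monotonicity gives [- h x >= - h N]. *)
Lemma legendre_has_lbound t : 0 < t ->
  has_lbound [set t * x - h x | x in `]0, +oo[%classic].
Proof.
move=> t0.
have : \forall x \near +oo, h x * x^-1 < t.
  by move/cvgr_lt : h_sublinear; apply.
case=> M [Mreal hM]; pose N := Num.max M 0 + 1.
have N0 : 0 < N by rewrite ltr_wpDl// le_max lexx orbT.
have MN : M < N by rewrite ltr_pwDr// le_max lexx.
exists (Num.min 0 (- h N)) => s [x /=]; rewrite in_itv/= andbT => x0 <-.
case: (lerP x N) => xN.
  rewrite ge_min; apply/orP; right.
  by have := h_nd x0 xN; have := mulr_gt0 t0 x0; lra.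
rewrite ge_min; apply/orP; left.
have := hM _ (lt_trans MN xN); rewrite ltr_pdivrMr//; lra.
Qed.

Lemma legendre_le t x : 0 < t -> 0 < x -> legendre h t <= t * x - h x.
Proof.
move=> t0 x0; apply: ge_inf; first exact: legendre_has_lbound.
by exists x => //=; rewrite in_itv/= andbT.
Qed.

Lemma le_legendre t a : (forall x, 0 < x -> a <= t * x - h x) ->
  a <= legendre h t.
Proof.
move=> ha; apply: lb_le_inf.
  by exists (t * 1 - h 1), 1 => //=; rewrite in_itv/= andbT.
by move=> s [x /=]; rewrite in_itv/= andbT => x0 <-; exact: ha.
Qed.

Definition conjugate_inv u : R := - legendre h u^-1.

Lemma conjugate_inv_ge z u : 0 < z -> 0 < u -> h z <= z / u + conjugate_inv u.
Proof.
move=> z0 u0; have := legendre_le _ z0 (t := u^-1).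
by rewrite invr_gt0 u0 /conjugate_inv mulrC; lra.
Qed.

Lemma conjugate_inv_nondecreasing x y : 0 < x -> x <= y ->
  conjugate_inv x <= conjugate_inv y.
Proof.
move=> x0 xy; rewrite lerN2; apply: le_legendre => z z0.
have y0 := lt_le_trans x0 xy.
have := legendre_le _ z0 (t := y^-1); rewrite invr_gt0 => /(_ y0) /le_trans; apply.
by rewrite lerD2r ler_pM2r// lef_pV2.
Qed.

(** The inversion in [conjugate_inv] turns the harmonic mean of [x^-1] and [y^-1] into the inverse
    of the arithmetic mean of [x] and [y], so the hypothesis is midpoint concavity. *)
Lemma conjugate_inv_concave :
  (forall x y, 0 < x -> 0 < y ->
    legendre h (2 / (x^-1 + y^-1)) <= (legendre h x + legendre h y) / 2) ->
  concave_pos conjugate_inv.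
Proof.
move=> hm; apply: midpoint_concave_pos; first exact: conjugate_inv_nondecreasing.
move=> x y x0 y0; have := hm x^-1 y^-1; rewrite !invr_gt0 => /(_ x0 y0).
by rewrite !invrK /conjugate_inv invf_div; lra.
Qed.

Lemma conjugate_inv_near z e : concave_pos h -> 0 < z -> 0 < e ->
  exists2 u, 0 < u & z / u + conjugate_inv u <= h z + e.
Proof.
move=> hc z0 e0.
have [c hz] := concave_supergradient hc z0.
have c0 : 0 <= c.
  by have := h_nd z0 (_ : z <= z + 1); have := hz (z + 1); lra.
(* The exact minimiser would be [u = c^-1], but [c] may be 0. Raising the slope by [e / z] makes it
   positive and costs exactly [e] at [z]. *)
pose t := c + e / z.
have ez : 0 < e / z by rewrite divr_gt0.
have t0 : 0 < t by rewrite ltr_wpDl.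
exists t^-1; rewrite ?invr_gt0// /conjugate_inv invrK.
have : c * z - h z <= legendre h t.
  apply: le_legendre => x x0; have := hz x x0.
  by have := mulr_gt0 ez x0; rewrite /t; lra.
have -> : z * t = c * z + e by rewrite /t; field; rewrite gt_eqF.
lra.
Qed.

End Legendre.
End ScalarConcavity.

(** * Functional calculus of Hermitian matrices *)

Section FunctionalCalculus.
Variable R : realType.
Local Open Scope sesquilinear_scope.
Local Notation C := R[i].

Lemma adjM m n p (A : 'M[C]_(m, n)) (B : 'M[C]_(n, p)) :
  (A *m B)^t* = B^t* *m A^t*.
Proof. by rewrite trmx_mul map_mxM. Qed.

Lemma adjD m n (A B : 'M[C]_(m, n)) : (A + B)^t* = A^t* + B^t*.
Proof. by rewrite linearD map_mxD. Qed.

Lemma conj_realC (a : R) : Num.conj (a%:C : C) = a%:C.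
Proof. by apply: conj_Creal; rewrite complex_real. Qed.

Lemma adjZ m n (a : R) (A : 'M[C]_(m, n)) : (a%:C *: A)^t* = a%:C *: A^t*.
Proof. by rewrite linearZ map_mxZ /= conj_realC. Qed.

Lemma hermE n (A : 'M[C]_n) : (A \is hermsymmx) <-> A^t* = A.
Proof.
by split=> [/is_hermitianmxP|AE]; last (apply/is_hermitianmxP);
  rewrite expr0 scale1r // => <-.
Qed.

Definition sqnorm (z : C) : R := (complex.Re z) ^+ 2 + (complex.Im z) ^+ 2.

Lemma sqnormE z : (sqnorm z)%:C = z * Num.conj z.
Proof. by rewrite add_Re2_Im2 normCK. Qed.

Lemma sqnorm_ge0 z : 0 <= sqnorm z.
Proof. by rewrite addr_ge0 ?sqr_ge0. Qed.

Definition eigenval n (A : 'M[C]_n) (i : 'I_n) : R :=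
  complex.Re (spectral_diag A 0 i).

Lemma mulmx_spectral_adj n (A : 'M[C]_n) :
  spectralmx A *m (spectralmx A)^t* = 1%:M.
Proof. exact/unitarymxP/spectral_unitarymx. Qed.

Lemma mulmx_adj_spectral n (A : 'M[C]_n) :
  (spectralmx A)^t* *m spectralmx A = 1%:M.
Proof. exact/mulmx1C/mulmx_spectral_adj. Qed.

Lemma mxfunE n (f : R -> R) (A : 'M[C]_n) :
  mxfun f A = (spectralmx A)^t* *m diag_mx (\row_i (f (eigenval A i))%:C)
                *m spectralmx A.
Proof.
rewrite /mxfun (invmx_unitary (spectral_unitarymx A)).
have -> // : map_mx (fun z => (f (complex.Re z))%:C) (spectral_diag A)
    = \row_i (f (eigenval A i))%:C.
by apply/rowP => i; rewrite !mxE.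
Qed.

Lemma mxfun_id n (A : 'M[C]_n) : A^t* = A -> mxfun id A = A.
Proof.
move=> /hermE Ah.
have /orthomx_spectralP AE := hermitian_normalmx Ah.
rewrite [RHS]AE /mxfun.
have -> // : map_mx (fun z => (id (complex.Re z))%:C) (spectral_diag A)
    = spectral_diag A.
apply/rowP => i; rewrite !mxE RRe_real//.
by have /mxOverP := hermitian_spectral_diag_real Ah; apply.
Qed.

Local Opaque mxfun.

Lemma eq_mxfun n (f g : R -> R) (A : 'M[C]_n) :
  (forall i, f (eigenval A i) = g (eigenval A i)) -> mxfun f A = mxfun g A.
Proof.
move=> fg; rewrite !mxfunE.
have -> // : \row_i (f (eigenval A i))%:C = \row_i (g (eigenval A i))%:C.
by apply/rowP => i; rewrite !mxE fg.
Qed.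

Lemma adj_diag_real n (d : 'I_n -> R) :
  (diag_mx (\row_i (d i)%:C))^t* = diag_mx (\row_i (d i)%:C).
Proof.
rewrite tr_diag_mx map_diag_mx; congr diag_mx; apply/rowP => i; rewrite !mxE.
exact: conj_realC.
Qed.

Lemma mxfun_herm n (f : R -> R) (A : 'M[C]_n) : (mxfun f A)^t* = mxfun f A.
Proof. by rewrite mxfunE !adjM trmxCK adj_diag_real mulmxA. Qed.

Lemma mxfunM n (f g : R -> R) (A : 'M[C]_n) :
  mxfun f A *m mxfun g A = mxfun (fun x => f x * g x) A.
Proof.
rewrite !mxfunE !mulmxA.
rewrite -[_ *m spectralmx A *m _]mulmxA mulmx_spectral_adj mulmx1.
rewrite -[_ *m diag_mx _ *m diag_mx _]mulmxA mulmx_diag.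
set u := \row_i (_ * _).
have -> // : u = \row_i (f (eigenval A i) * g (eigenval A i))%:C.
by apply/rowP => i; rewrite !mxE rmorphM.
Qed.

Lemma mxfun_mulmx n (f : R -> R) (A : 'M[C]_n) : A^t* = A ->
  mxfun f A *m A = mxfun (fun x => f x * x) A.
Proof. by move=> Ah; have := mxfunM f id A; rewrite (mxfun_id Ah). Qed.

Lemma mxfun1 n (A : 'M[C]_n) : mxfun (fun=> 1) A = 1%:M.
Proof.
rewrite mxfunE (_ : \row_i _ = const_mx 1) ?diag_const_mx ?mulmx1 ?mulmx_adj_spectral//.
by apply/rowP => i; rewrite !mxE.
Qed.

Lemma trfunE n (f : R -> R) (A : 'M[C]_n) : trfun f A = \sum_i f (eigenval A i).
Proof.
rewrite /trfun mxfunE -mulmxA mxtrace_mulC -mulmxA mulmx_spectral_adj mulmx1.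
rewrite mxtrace_diag (eq_bigr (fun i => (f (eigenval A i))%:C)) => [|i _].
  by rewrite -rmorph_sum.
by rewrite mxE.
Qed.

(** In an eigenbasis of [A] the relation says that an entry [N i j] vanishes unless
    [d i = eigenval A j]; then [f] takes equal values there too. The argument is entrywise and works
    for an arbitrary [f]. *)
Lemma mxfun_diag_intertwine m n (f : R -> R) (d : 'I_m -> R) (M : 'M[C]_(m, n))
    (A : 'M[C]_n) : A^t* = A ->
  diag_mx (\row_i (d i)%:C) *m M = M *m A ->
  diag_mx (\row_i (f (d i))%:C) *m M = M *m mxfun f A.
Proof.
move=> Ah dM.
pose N := M *m (spectralmx A)^t*.
have MN : M = N *m spectralmx A by rewrite -mulmxA mulmx_adj_spectral mulmx1.
have dN : diag_mx (\row_i (d i)%:C) *m N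
    = N *m diag_mx (\row_i (eigenval A i)%:C).
  rewrite /N mulmxA dM -{1}[A in LHS](mxfun_id Ah) mxfunE !mulmxA -mulmxA.
  by rewrite mulmx_spectral_adj mulmx1.
rewrite mxfunE !mulmxA -/N {1}MN mulmxA; congr (_ *m _).
clearbody N; apply/matrixP => i j; move/matrixP/(_ i j) : dN.
rewrite !mul_diag_mx !mul_mx_diag !mxE => dN.
have [->|N0] := eqVneq (N i j) 0; first by rewrite mulr0 mul0r.
have -> : d i = eigenval A j.
  by apply: complexI; apply: (mulIf N0); rewrite dN mulrC.
by rewrite mulrC.
Qed.

Lemma spectralmxM n (A : 'M[C]_n) : A^t* = A ->
  spectralmx A *m A = diag_mx (\row_i (eigenval A i)%:C) *m spectralmx A.
Proof.
move=> Ah; rewrite -[X in _ *m X = _](mxfun_id Ah) mxfunE !mulmxA.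
by rewrite mulmx_spectral_adj mul1mx.
Qed.

(** One statement covers several uses: [M] is unitary for rotations, rectangular for diagonal
    blocks, and merely invertible for similarity. *)
Lemma mxfun_intertwine m n (f : R -> R) (A : 'M[C]_m) (B : 'M[C]_n)
    (M : 'M[C]_(m, n)) : A^t* = A -> B^t* = B ->
  A *m M = M *m B -> mxfun f A *m M = M *m mxfun f B.
Proof.
move=> Ah Bh AM.
rewrite mxfunE -!mulmxA.
rewrite (@mxfun_diag_intertwine _ _ f (eigenval A) (spectralmx A *m M) B)//.
  by rewrite !mulmxA mulmx_adj_spectral mul1mx.
by rewrite -[RHS]mulmxA -AM !mulmxA spectralmxM.
Qed.

(** The eigenbasis chosen for [mxfun g A] may differ from that of [A]; intertwining with
    [spectralmx A] bridges the two. *)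
Lemma mxfun_comp n (f g : R -> R) (A : 'M[C]_n) :
  mxfun f (mxfun g A) = mxfun (f \o g) A.
Proof.
have E : diag_mx (\row_i (g (eigenval A i))%:C) *m spectralmx A
    = spectralmx A *m mxfun g A.
  by rewrite mxfunE !mulmxA mulmx_spectral_adj mul1mx.
rewrite [RHS]mxfunE -mulmxA (mxfun_diag_intertwine f (mxfun_herm g A) E).
by rewrite mulmxA mulmx_adj_spectral mul1mx.
Qed.

Lemma trfun_similar n (f : R -> R) (A B M : 'M[C]_n) : A^t* = A -> B^t* = B ->
  M \in unitmx -> A *m M = M *m B -> trfun f A = trfun f B.
Proof.
move=> Ah Bh Mu /(mxfun_intertwine f Ah Bh) E; rewrite /trfun.
by rewrite -[mxfun f A](mulmxK Mu) E mxtrace_mulC mulKmx.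
Qed.

(** With a single row [X] this is a quadratic form. With a unitary [X] the weights form a doubly
    stochastic matrix, which turns trace inequalities into averages over eigenvalues. *)
Lemma mxfun_form m n (f : R -> R) (A : 'M[C]_n) (X : 'M[C]_(m, n)) i :
  (X *m mxfun f A *m X^t*) i i =
    (\sum_j f (eigenval A j) * sqnorm ((X *m (spectralmx A)^t*) i j))%:C.
Proof.
pose N := X *m (spectralmx A)^t*; rewrite -/N.
have -> : X *m mxfun f A *m X^t* =
    N *m diag_mx (\row_i (f (eigenval A i))%:C) *m N^t*.
  by rewrite mxfunE /N adjM trmxCK !mulmxA.
rewrite mul_mx_diag mxE rmorph_sum; apply: eq_bigr => j _.
by rewrite !mxE rmorphM /= sqnormE mulrAC mulrC.
Qed.

Lemma sqnorm_unitary_row n (U : 'M[C]_n) i : U \is unitarymx ->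
  \sum_j sqnorm (U i j) = 1.
Proof.
move=> /unitarymxP/matrixP/(_ i i); rewrite !mxE eqxx => E.
apply: complexI; rewrite rmorph_sum/= -[RHS]E; apply: eq_bigr => j _.
by rewrite sqnormE !mxE.
Qed.

Lemma sqnorm_unitary_col n (U : 'M[C]_n) j : U \is unitarymx ->
  \sum_i sqnorm (U i j) = 1.
Proof.
rewrite -trmx_unitary => /(sqnorm_unitary_row j) <-.
by apply: eq_bigr => i _; rewrite mxE.
Qed.

End FunctionalCalculus.

(** * Positive semidefinite and positive definite matrices *)

Section PositiveMatrices.
Variable R : realType.
Local Open Scope sesquilinear_scope.
Local Notation C := R[i].
Local Opaque mxfun.

Lemma psdmx_herm n (A : 'M[C]_n) : psdmx A -> A^t* = A.
Proof. by case=> /hermE. Qed.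

Lemma pdmx_herm n (A : 'M[C]_n) : pdmx A -> A^t* = A.
Proof. by case=> /psdmx_herm. Qed.

Lemma psdmx_congr m n (X : 'M[C]_(m, n)) (A : 'M[C]_n) :
  psdmx A -> psdmx (X *m A *m X^t*).
Proof.
move=> Apsd; split; first by apply/hermE; rewrite !adjM trmxCK (psdmx_herm Apsd) mulmxA.
by move=> v; have := Apsd.2 (v *m X); rewrite adjM !mulmxA.
Qed.

Lemma pdmx_congr n (X A : 'M[C]_n) : X \in unitmx ->
  pdmx A -> pdmx (X *m A *m X^t*).
Proof.
move=> Xu [Apsd Au]; split; first exact: psdmx_congr.
by rewrite !unitmx_mul Xu Au /= map_unitmx unitmx_tr.
Qed.

Lemma psdmxD n (A B : 'M[C]_n) : psdmx A -> psdmx B -> psdmx (A + B).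
Proof.
move=> Apsd Bpsd; split.
  by apply/hermE; rewrite adjD (psdmx_herm Apsd) (psdmx_herm Bpsd).
move=> v; rewrite mulmxDr mulmxDl mxE.
by apply: addr_ge0; [exact: Apsd.2 | exact: Bpsd.2].
Qed.

Lemma psdmxZ n (a : R) (A : 'M[C]_n) : 0 <= a -> psdmx A -> psdmx (a%:C *: A).
Proof.
move=> a0 Apsd; split; first by apply/hermE; rewrite adjZ (psdmx_herm Apsd).
move=> v; rewrite -scalemxAr -scalemxAl mxE mulr_ge0 ?ler0c//.
exact: Apsd.2.
Qed.

Lemma spectralmx_diag n (A : 'M[C]_n) : A^t* = A ->
  spectralmx A *m A *m (spectralmx A)^t* = diag_mx (\row_i (eigenval A i)%:C).
Proof.
by move=> Ah; rewrite spectralmxM// -mulmxA mulmx_spectral_adj mulmx1.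
Qed.

Lemma psdmx_eigenval_ge0 n (A : 'M[C]_n) i : psdmx A -> 0 <= eigenval A i.
Proof.
move=> Apsd; have := psdmx_congr (spectralmx A) Apsd.
rewrite spectralmx_diag ?psdmx_herm// => -[_ /(_ (delta_mx 0 i))].
rewrite -rowE trmx_delta map_delta_mx -colE.
by rewrite !mxE eqxx mulr1n ler0c.
Qed.

Lemma pdmx_eigenval_gt0 n (A : 'M[C]_n) i : pdmx A -> 0 < eigenval A i.
Proof.
move=> [Apsd Au]; rewrite lt_def psdmx_eigenval_ge0// andbT.
apply/eqP => ev0; move: Au.
have -> : A = mxfun id A by rewrite mxfun_id// psdmx_herm.
rewrite mxfunE !unitmx_mul => /andP[/andP[_]].
by rewrite unitmxE det_diag (bigD1 i)//= mxE ev0 mul0r unitr0.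
Qed.

Lemma psdmx_mxfun n (f : R -> R) (A : 'M[C]_n) :
  (forall i, 0 <= f (eigenval A i)) -> psdmx (mxfun f A).
Proof.
move=> f0; split; first by apply/hermE; exact: mxfun_herm.
move=> v; rewrite mxfun_form ler0c sumr_ge0// => j _.
by rewrite mulr_ge0 ?sqnorm_ge0.
Qed.

Lemma mxfun_inv n (f : R -> R) (A : 'M[C]_n) :
  (forall i, f (eigenval A i) != 0) ->
  mxfun f A *m mxfun (fun x => (f x)^-1) A = 1%:M.
Proof.
move=> f0; rewrite mxfunM -(mxfun1 A); apply: eq_mxfun => i.
by rewrite mulfV.
Qed.

Lemma pdmx_mxfun n (f : R -> R) (A : 'M[C]_n) :
  (forall i, 0 < f (eigenval A i)) -> pdmx (mxfun f A).
Proof.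
move=> f0; split; first by apply: psdmx_mxfun => i; exact: ltW.
have f_neq0 i : f (eigenval A i) != 0 by rewrite gt_eqF.
have [fu _] := mulmx1_unit (mxfun_inv f_neq0).
exact: fu.
Qed.

Lemma invmx_mxfun n (f : R -> R) (A : 'M[C]_n) :
  (forall i, f (eigenval A i) != 0) ->
  invmx (mxfun f A) = mxfun (fun x => (f x)^-1) A.
Proof.
move=> f0; have E := mxfun_inv f0; have [fu _] := mulmx1_unit E.
by rewrite -[LHS]mulmx1 -E mulKmx.
Qed.

Lemma pdmx_sqrt n (A : 'M[C]_n) : pdmx A -> pdmx (sqrtmx A).
Proof.
by move=> Apd; apply: pdmx_mxfun => i; rewrite sqrtr_gt0 pdmx_eigenval_gt0.
Qed.

Lemma sqrtmxM n (A : 'M[C]_n) : psdmx A -> sqrtmx A *m sqrtmx A = A.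
Proof.
move=> Apsd; rewrite -[RHS](mxfun_id (psdmx_herm Apsd)) [LHS]mxfunM.
by apply: eq_mxfun => i; rewrite -expr2 sqr_sqrtr// psdmx_eigenval_ge0.
Qed.

Lemma pdmx_form_eq0 n (A : 'M[C]_n) (v : 'rV[C]_n) : pdmx A ->
  (v *m A *m v^t*) 0 0 = 0 -> v = 0.
Proof.
move=> Apd; rewrite -[X in _ *m X *m _](mxfun_id (pdmx_herm Apd)) mxfun_form.
move=> /complexI/eqP; rewrite psumr_eq0 => [/allP /= v0|j _]; last first.
  by rewrite mulr_ge0 ?sqnorm_ge0// ltW// pdmx_eigenval_gt0.
have vP : v *m (spectralmx A)^t* = 0.
  apply/rowP => j; have := v0 j (mem_index_enum _).
  rewrite mulf_eq0 gt_eqF ?pdmx_eigenval_gt0//= => /eqP E.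
  have /eqP := sqnormE ((v *m (spectralmx A)^t*) 0 j).
  by rewrite E -normCK eq_sym sqrf_eq0 normr_eq0 => /eqP ->; rewrite mxE.
by rewrite -[v]mulmx1 -(mulmx_adj_spectral A) mulmxA vP mul0mx.
Qed.

Lemma pdmxD n (A B : 'M[C]_n) : psdmx A -> pdmx B -> pdmx (A + B).
Proof.
move=> Apsd Bpd; split; first by apply: psdmxD; [|case: Bpd].
rewrite -row_free_unit; apply: inj_row_free => v vAB.
apply: (pdmx_form_eq0 Bpd); apply: le_anti; rewrite Bpd.1.2 andbT.
have : (v *m (A + B) *m v^t*) 0 0 = 0 by rewrite vAB mul0mx mxE.
rewrite mulmxDr mulmxDl mxE => /eqP; rewrite addrC addr_eq0 => /eqP ->.
by rewrite oppr_le0; exact: Apsd.2.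
Qed.

Lemma pdmxZ n (a : R) (A : 'M[C]_n) : 0 < a -> pdmx A -> pdmx (a%:C *: A).
Proof.
move=> a0 [Apsd Au]; split; first by apply: psdmxZ => //; exact: ltW.
by rewrite unitmxZ// unitfE; apply/eqP => -[/eqP]; rewrite gt_eqF.
Qed.

Lemma pdmx_conv n (A B : 'M[C]_n) (t : R) : 0 <= t <= 1 -> pdmx A -> pdmx B ->
  pdmx (t%:C *: A + (1 - t)%:C *: B).
Proof.
move=> /andP[t0 t1] Apd Bpd; case: (ltrP 0 t) => [t_gt0|t_le0].
  rewrite addrC; apply: pdmxD; last exact: pdmxZ.
  by apply: psdmxZ; [lra | case: Bpd].
by apply: pdmxD; [apply: psdmxZ; [|case: Apd] | apply: pdmxZ => //; lra].
Qed.

Lemma pdmx1 n : pdmx (1%:M : 'M[C]_n).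
Proof. by rewrite -(mxfun1 (0 : 'M[C]_n)); apply: pdmx_mxfun. Qed.

(** Closedness of the positive cone along a ray, checked on each quadratic form. It replaces
    topology on matrices in every limit taken below. *)
Lemma psdmx_lim n (A B : 'M[C]_n) : psdmx A ->
  (forall e : R, 0 < e < 1 -> psdmx (B + e%:C *: A)) -> psdmx B.
Proof.
move=> Apsd AB.
have half : 0 < (2^-1 : R) < 1 by lra.
split.
  apply/hermE; have := psdmx_herm (AB _ half).
  by rewrite adjD adjZ (psdmx_herm Apsd) => /addIr.
move=> v.
have qE (e : R) : (v *m (B + e%:C *: A) *m v^t*) 0 0 =
    (v *m B *m v^t*) 0 0 + e%:C * (v *m A *m v^t*) 0 0.
  by rewrite mulmxDr mulmxDl mxE -scalemxAr -scalemxAl [X in _ + X]mxE.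
have [r r0 rE] : exists2 r : R, 0 <= r & (v *m A *m v^t*) 0 0 = r%:C.
  exists (complex.Re ((v *m A *m v^t*) 0 0)).
    by have := Apsd.2 v; rewrite lecE => /andP[].
  by rewrite RRe_real// ger0_real//; exact: Apsd.2.
move: qE; rewrite rE; case: (_ 0 0) => a b qE.
have ge (e : R) : 0 < e < 1 -> b = 0 /\ 0 <= a + e * r.
  move=> e01; have := (AB e e01).2 v; rewrite qE lecE /= !mul0r.
  rewrite !addr0 mulr0 subr0 addr0.
  by case/andP => /eqP.
have [-> _] := ge _ half.
rewrite lecE /= eqxx /= leNgt; apply/negP => a0.
(* Chosen so that [a + e * r] equals [a * (1 - a) / (1 + r - a)], which is negative when [a] is. *)
pose e := - a / (1 + r - a).
have d0 : 0 < 1 + r - a by lra.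
have e01 : 0 < e < 1.
  by apply/andP; split; [apply: divr_gt0 | rewrite ltr_pdivrMr//]; lra.
have [_] := ge _ e01; apply/negP; rewrite -ltNge.
have -> : a + e * r = a * (1 - a) / (1 + r - a).
  by rewrite /e; field; rewrite gt_eqF.
by rewrite ltr_pdivrMr// mul0r nmulr_rlt0//; lra.
Qed.

Lemma psdmx_trace_ge0 n (A : 'M[C]_n) : psdmx A -> 0 <= complex.Re (\tr A).
Proof.
move=> Apsd; suff : 0 <= \tr A by rewrite lecE => /andP[].
rewrite /mxtrace sumr_ge0// => i _.
have := Apsd.2 (delta_mx 0 i); rewrite -rowE.
have -> : ((delta_mx 0 i : 'rV[C]_n)^t*) = delta_mx i 0.
  by rewrite trmx_delta map_delta_mx.
by rewrite -colE !mxE.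
Qed.

End PositiveMatrices.

(** * Positive operator monotone functions are operator concave *)

Section OperatorConcavity.
Variable R : realType.
Local Open Scope sesquilinear_scope.
Local Notation C := R[i].
Local Opaque mxfun.

Lemma adj_scalar n (a : R) : (a%:C%:M : 'M[C]_n)^t* = a%:C%:M.
Proof. by rewrite tr_scalar_mx map_scalar_mx /= conj_realC. Qed.

Lemma adj_block m n (A : 'M[C]_m) B D (E : 'M[C]_n) :
  (block_mx A B D E)^t* = block_mx (A^t*) (D^t*) (B^t*) (E^t*).
Proof. by rewrite tr_block_mx map_block_mx. Qed.

Lemma psdmx_block m n (A : 'M[C]_m) (B : 'M[C]_n) :
  psdmx A -> psdmx B -> psdmx (block_mx A 0 0 B).
Proof.
move=> Apsd Bpsd; split.
  by apply/hermE; rewrite adj_block !trmx0 !map_mx0 !psdmx_herm.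
move=> v; rewrite -[v]hsubmxK mul_row_block !mulmx0 addr0 add0r.
rewrite tr_row_mx map_col_mx mul_row_col mxE.
by apply: addr_ge0; [exact: Apsd.2 | exact: Bpsd.2].
Qed.

Lemma pdmx_block m n (A : 'M[C]_m) (B : 'M[C]_n) :
  pdmx A -> pdmx B -> pdmx (block_mx A 0 0 B).
Proof.
move=> [Apsd Au] [Bpsd Bu]; split; first exact: psdmx_block.
by move: Au Bu; rewrite !unitmxE det_ublock unitrM => -> ->.
Qed.

Lemma psdmx_ulsub m n (A : 'M[C]_(m + n)) : psdmx A -> psdmx (ulsubmx A).
Proof.
move=> /(psdmx_congr (row_mx 1%:M 0 : 'M[C]_(m, m + n))).
rewrite -{1}[A]submxK mul_row_block !mul1mx !mul0mx !addr0.
rewrite tr_row_mx map_col_mx mul_row_col trmx1 map_mx1 trmx0 map_mx0.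
by rewrite mulmx1 mulmx0 addr0.
Qed.

Lemma loewner_ulsub m n (A B : 'M[C]_(m + n)) :
  loewner_le A B -> loewner_le (ulsubmx A) (ulsubmx B).
Proof.
move=> /psdmx_ulsub; rewrite /loewner_le.
have -> // : ulsubmx (B - A) = ulsubmx B - ulsubmx A.
by apply/matrixP => i j; rewrite !mxE.
Qed.

Lemma mxfun_block m n (f : R -> R) (A : 'M[C]_m) (B : 'M[C]_n) :
  A^t* = A -> B^t* = B ->
  mxfun f (block_mx A 0 0 B) = block_mx (mxfun f A) 0 0 (mxfun f B).
Proof.
move=> Ah Bh.
have Dh : (block_mx A 0 0 B)^t* = block_mx A 0 0 B.
  by rewrite adj_block !trmx0 !map_mx0 Ah Bh.
(* The coordinate projections intertwine each block with the whole matrix; stacked, they form the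
   identity. *)
have uE : mxfun f A *m row_mx 1%:M 0 = row_mx 1%:M 0 *m mxfun f (block_mx A 0 0 B).
  apply: mxfun_intertwine => //.
  by rewrite mul_row_block mul_mx_row !mulmx0 !mul0mx !mulmx1 !mul1mx !addr0.
have dE : mxfun f B *m row_mx 0 1%:M = row_mx 0 1%:M *m mxfun f (block_mx A 0 0 B).
  apply: mxfun_intertwine => //.
  by rewrite mul_row_block mul_mx_row !mulmx0 !mul0mx !mulmx1 !mul1mx !add0r.
rewrite -[LHS]mul1mx scalar_mx_block /block_mx mul_col_mx -uE -dE.
by rewrite !mul_mx_row !mulmx0 !mulmx1.
Qed.

(* The difference is the congruence of [W] by [diag (sqrt d, - 1 / sqrt d)]. *)
Lemma psdmx_pinching n (W : 'M[C]_(n + n)) (d : R) : 0 < d -> psdmx W ->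
  loewner_le W (block_mx ((1 + d)%:C *: ulsubmx W) 0 0
                         ((1 + d^-1)%:C *: drsubmx W)).
Proof.
move=> d0; rewrite -[W]submxK block_mxKul block_mxKdr.
set K := ursubmx W; set K' := dlsubmx W; set P := ulsubmx W; set L := drsubmx W.
move: K K' P L => K K' P L Wpsd; rewrite /loewner_le; pose s := Num.sqrt d.
have s0 : s != 0 by rewrite gt_eqF// sqrtr_gt0.
have sd : s * s = d by rewrite -expr2 sqr_sqrtr// ltW.
pose S : 'M[C]_(n + n) := block_mx s%:C%:M 0 0 ((- s^-1)%:C%:M).
suff -> : block_mx ((1 + d)%:C *: P) 0 0 ((1 + d^-1)%:C *: L) - block_mx P K K' L
    = S *m block_mx P K K' L *m S^t* by exact: psdmx_congr.
rewrite /S adj_block !trmx0 !map_mx0 !adj_scalar.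
rewrite !mulmx_block !mulmx0 !mul0mx !addr0 !add0r opp_block_mx add_block_mx.
rewrite !add0r !mul_scalar_mx !mul_mx_scalar !scalerA -!rmorphM.
rewrite mulNr mulrN mulVf// mulfV// sd mulrNN -invfM sd.
congr block_mx.
- by rewrite -[X in _ - X]scale1r -scalerBl -rmorphB/=; congr (_ %:C *: _); ring.
- by rewrite rmorphN1 scaleN1r.
- by rewrite rmorphN1 scaleN1r.
- by rewrite -[X in _ - X]scale1r -scalerBl -rmorphB/=; congr (_ %:C *: _); ring.
Qed.

Variable f : R -> R.
Hypothesis f_pos : forall x, 0 < x -> 0 < f x.
Hypothesis f_mon : operator_monotone f.

Lemma pdmx_mxfun_pos n (A : 'M[C]_n) : pdmx A -> pdmx (mxfun f A).
Proof. by move=> Apd; apply: pdmx_mxfun => i; exact/f_pos/pdmx_eigenval_gt0. Qed.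

(** Monotonicity is applied in size [n + n]. Rotating [diag (A, B)] by [U] gives [W], whose upper
    left corner is the convex combination, and [f] commutes with the rotation. As [W] is not block
    diagonal, it is first dominated by its pinching, whose corner is dilated by [1 + d]; then the
    corners of [f] are compared. *)
Lemma operator_monotone_conv_dilate n (A B : 'M[C]_n) (t d : R) :
  pdmx A -> pdmx B -> 0 <= t <= 1 -> 0 < d ->
  loewner_le (t%:C *: mxfun f A + (1 - t)%:C *: mxfun f B)
             (mxfun f ((1 + d)%:C *: (t%:C *: A + (1 - t)%:C *: B))).
Proof.
move=> Apd Bpd t01 d0; have /andP[t0 t1] := t01.
pose a := Num.sqrt t; pose b := Num.sqrt (1 - t).
have aa : a * a = t by rewrite -expr2 sqr_sqrtr.
have bb : b * b = 1 - t by rewrite -expr2 sqr_sqrtr// subr_ge0.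
pose U : 'M[C]_(n + n) := block_mx a%:C%:M (- b)%:C%:M b%:C%:M a%:C%:M.
have UUt : U *m U^t* = 1%:M.
  rewrite /U adj_block !adj_scalar mulmx_block -!scalar_mxM -!rmorphM.
  rewrite -!raddfD /= !mulrNN !mulrN !mulNr aa bb.
  rewrite [t + _]addrC subrK [b * a]mulrC subrr !raddf0.
  by rewrite -scalar_mx_block.
have UtU := mulmx1C UUt.
pose conjU (X Y : 'M[C]_n) := U^t* *m block_mx X 0 0 Y *m U.
have ulU X Y : ulsubmx (conjU X Y) = t%:C *: X + (1 - t)%:C *: Y.
  rewrite /conjU /U adj_block !adj_scalar !mulmx_block block_mxKul.
  rewrite !mulmx0 !addr0 !add0r !mul_scalar_mx !mul_mx_scalar !scalerA.
  by rewrite -!rmorphM aa bb.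
have drU X Y : drsubmx (conjU X Y) = (1 - t)%:C *: X + (1 - (1 - t))%:C *: Y.
  rewrite /conjU /U adj_block !adj_scalar !mulmx_block block_mxKdr.
  rewrite !mulmx0 !addr0 !add0r !mul_scalar_mx !mul_mx_scalar !scalerA.
  by rewrite -!rmorphM mulrNN aa bb subKr.
pose W := conjU A B.
have [Ut_unit _] := mulmx1_unit UtU.
have Wpd : pdmx W.
  have := pdmx_congr Ut_unit (pdmx_block Apd Bpd).
  by rewrite trmxCK.
have fW : mxfun f W = conjU (mxfun f A) (mxfun f B).
  have : mxfun f (block_mx A 0 0 B) *m U = U *m mxfun f W.
    apply: mxfun_intertwine; [exact/pdmx_herm/pdmx_block|exact: pdmx_herm|].
    by rewrite /W /conjU !mulmxA UUt mul1mx.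
  rewrite (mxfun_block f (pdmx_herm Apd) (pdmx_herm Bpd)) /conjU -mulmxA => ->.
  by rewrite mulmxA UtU mul1mx.
have := psdmx_pinching d0 Wpd.1; rewrite ulU drU.
set V1 := _ *: (_ + _); set V2 := _ *: (_ + _) => WV.
have V1pd : pdmx V1 by apply: pdmxZ; [lra | exact: pdmx_conv].
have V2pd : pdmx V2.
  apply: pdmxZ; first by rewrite ltr_wpDl// invr_gt0.
  by apply: pdmx_conv => //; lra.
have := loewner_ulsub (f_mon Wpd (pdmx_block V1pd V2pd) WV).
by rewrite (mxfun_block f (pdmx_herm V1pd) (pdmx_herm V2pd)) block_mxKul fW ulU.
Qed.

(** A quantitative substitute for continuity. [A] is the dilated convex combination of [(1 + d) A]
    and some [y A], with weight [t] on the former; discarding the positive term in [f (y A)] leaves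
    [t f ((1 + d) A) <= f A]. *)
Lemma operator_monotone_dilate n (A : 'M[C]_n) (d : R) : pdmx A -> 0 < d ->
  loewner_le (mxfun f ((1 + d)%:C *: A)) (((1 + d) ^+ 3)%:C *: mxfun f A).
Proof.
move=> Apd d0.
have d1 : 1 < 1 + d by lra.
have d1_gt0 : 0 < 1 + d by lra.
pose t := (1 + d) ^- 3.
have t0 : 0 < t by rewrite invr_gt0 exprn_gt0.
have t1 : t < 1 by rewrite invf_lt1 ?exprn_gt0// exprn_egt1.
(* Solves [(1 + d) (t (1 + d) + (1 - t) y) = 1]. Positivity of [y] requires [t < (1 + d)^-2], hence
   the exponent 3 in [t]. *)
pose y := ((1 + d)^-1 - t * (1 + d)) / (1 - t).
have y0 : 0 < y.
  rewrite divr_gt0 ?subr_gt0//.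
  have -> : t * (1 + d) = (1 + d)^-1 * (1 + d)^-1 by rewrite /t; field; lra.
  by rewrite gtr_pMr ?invr_gt0// invf_lt1.
have t01 : 0 <= t <= 1 by rewrite !ltW.
have := operator_monotone_conv_dilate (pdmxZ d1_gt0 Apd) (pdmxZ y0 Apd) t01 d0.
have -> : (1 + d)%:C *: (t%:C *: ((1 + d)%:C *: A) + (1 - t)%:C *: (y%:C *: A)) = A.
  rewrite !scalerA -scalerDl -!rmorphM -rmorphD scalerA -rmorphM.
  rewrite (_ : (1 + d) * _ = 1) ?scale1r// /y.
  have t1_neq0 : 1 - t != 0 by rewrite gt_eqF// subr_gt0.
  have d1_neq0 : 1 + d != 0 by rewrite gt_eqF.
  by field; rewrite ?t1_neq0 ?d1_neq0.
rewrite /loewner_le => le.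
have -> : ((1 + d) ^+ 3)%:C *: mxfun f A - mxfun f ((1 + d)%:C *: A) =
    ((1 + d) ^+ 3)%:C *: (mxfun f A - (t%:C *: mxfun f ((1 + d)%:C *: A) +
       (1 - t)%:C *: mxfun f (y%:C *: A)) + (1 - t)%:C *: mxfun f (y%:C *: A)).
  rewrite opprD addrA subrK scalerBr scalerA -rmorphM divff ?scale1r//.
  by rewrite expf_neq0// gt_eqF.
apply: psdmxZ; first by rewrite exprn_ge0// ltW.
apply: psdmxD; first exact: le.
apply: psdmxZ; first by lra.
exact: (pdmx_mxfun_pos (pdmxZ y0 Apd)).1.
Qed.

Lemma operator_monotone_concave n (A B : 'M[C]_n) (t : R) :
  pdmx A -> pdmx B -> 0 <= t <= 1 ->
  loewner_le (t%:C *: mxfun f A + (1 - t)%:C *: mxfun f B)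
             (mxfun f (t%:C *: A + (1 - t)%:C *: B)).
Proof.
move=> Apd Bpd t01.
set K := t%:C *: mxfun f A + _; pose M := t%:C *: A + (1 - t)%:C *: B.
rewrite -/M; have Mpd : pdmx M by exact: pdmx_conv.
have [fM _] := pdmx_mxfun_pos Mpd.
apply: (psdmx_lim fM) => e /andP[e0 e1].
(* For [0 < d < 1], [(1 + d) ^ 3 = 1 + 3 d + 3 d ^ 2 + d ^ 3 <= 1 + 7 d = 1 + e]. *)
pose d := e / 7.
have d0 : 0 < d by rewrite divr_gt0.
have c0 : 0 <= 1 + e - (1 + d) ^+ 3.
  have -> : e = 7 * d by rewrite /d; field.
  have d1 : d < 1 by rewrite /d; lra.
  nra.
have le_f : loewner_le K (mxfun f ((1 + d)%:C *: M)).
  exact: operator_monotone_conv_dilate.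
have := psdmxD (psdmxZ c0 fM) (psdmxD (operator_monotone_dilate Mpd d0) le_f).
move: (mxfun f M) (mxfun f _) => X Y; clearbody K.
rewrite !addrA subrK -scalerDl -rmorphD subrK rmorphD scalerDl rmorph1.
by rewrite scale1r addrAC.
Qed.

End OperatorConcavity.

(** * Concavity and duality for trace functions *)

Section TraceFunctions.
Variable R : realType.
Local Open Scope sesquilinear_scope.
Local Notation C := R[i].
Local Opaque mxfun.

Lemma Re_sum (I : finType) (F : I -> C) :
  complex.Re (\sum_i F i) = \sum_i complex.Re (F i).
Proof. exact: (raddf_sum (@complex.Re R)). Qed.

Lemma ReD (x y : C) : complex.Re (x + y) = complex.Re x + complex.Re y.
Proof. by case: x; case: y. Qed.

Lemma ReZ (a : R) (x : C) : complex.Re (a%:C * x) = a * complex.Re x.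
Proof. by case: x => x y /=; rewrite mul0r subr0. Qed.

Lemma Re_tr_conv n (H Y1 Y2 : 'M[C]_n) (t : R) :
  complex.Re (\tr (H *m (t%:C *: Y1 + (1 - t)%:C *: Y2))) =
  t * complex.Re (\tr (H *m Y1)) + (1 - t) * complex.Re (\tr (H *m Y2)).
Proof.
by rewrite mulmxDr -!scalemxAr mxtraceD !mxtraceZ ReD !ReZ.
Qed.

Lemma Re_tr_gram_le n (G A B : 'M[C]_n) : loewner_le A B ->
  complex.Re (\tr (G^t* *m G *m A)) <= complex.Re (\tr (G^t* *m G *m B)).
Proof.
move=> /(psdmx_congr G)/psdmx_trace_ge0.
by rewrite mxtrace_mulC mulmxA mulmxBr raddfB raddfB /= subr_ge0.
Qed.

Lemma weighted_mean_gt0 n (w a : 'I_n -> R) : (forall j, 0 <= w j) ->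
  \sum_j w j = 1 -> (forall j, 0 < a j) -> 0 < \sum_j a j * w j.
Proof.
move=> w0 w1 a0; have aw0 j : 0 <= a j * w j by rewrite mulr_ge0// ltW.
rewrite lt_def sumr_ge0 ?andbT//; apply/eqP => /eqP.
rewrite psumr_eq0// => /allP s0; move/eqP: w1.
rewrite big1 ?(eq_sym 0) ?oner_eq0// => j _.
have := s0 j (mem_index_enum _); rewrite mulf_eq0 gt_eqF// => /eqP //.
Qed.

(** Averaging the supergradient inequality at the mean [z] makes the linear term vanish. *)
Lemma concave_pos_jensen (phi : R -> R) n (w a : 'I_n -> R) : concave_pos phi ->
  (forall j, 0 <= w j) -> \sum_j w j = 1 -> (forall j, 0 < a j) ->
  \sum_j phi (a j) * w j <= phi (\sum_j a j * w j).
Proof.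
move=> phi_c w0 w1 a0; set z := \sum_j a j * w j.
have z0 : 0 < z by exact: weighted_mean_gt0.
have [c phi_le] := concave_supergradient phi_c z0.
apply: (@le_trans _ _ (\sum_j (phi z + c * (a j - z)) * w j)).
  by apply: ler_sum => j _; apply: ler_wpM2r => //; exact: phi_le.
rewrite (eq_bigr (fun j => (phi z - c * z) * w j + c * (a j * w j))); last first.
  by move=> j _; ring.
rewrite big_split /= -!mulr_sumr w1 -/z; lra.
Qed.

Lemma spectral_weight_unitary n (A B : 'M[C]_n) :
  spectralmx A *m (spectralmx B)^t* \is unitarymx.
Proof.
by rewrite mul_unitarymx ?trmxC_unitary ?spectral_unitarymx.
Qed.

(* Peierls: evaluating in an eigenbasis of [A], concavity of [phi] passes from
   the diagonal entries of [A1] and [A2] to their eigenvalues by Jensen. *)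
Lemma trfun_concave (phi : R -> R) n (A A1 A2 : 'M[C]_n) (t : R) :
  concave_pos phi -> (forall x y, 0 < x -> x <= y -> phi x <= phi y) ->
  pdmx A -> pdmx A1 -> pdmx A2 -> 0 <= t <= 1 ->
  loewner_le (t%:C *: A1 + (1 - t)%:C *: A2) A ->
  t * trfun phi A1 + (1 - t) * trfun phi A2 <= trfun phi A.
Proof.
move=> phi_c phi_nd Apd A1pd A2pd t01 leA; have /andP[t0 t1] := t01.
pose w B i j := sqnorm ((spectralmx A *m (spectralmx B)^t*) i j).
pose mean B i := \sum_j eigenval B j * w B i j.
have w0 B i j : 0 <= w B i j by exact: sqnorm_ge0.
have w_row B i : \sum_j w B i j = 1.
  exact/sqnorm_unitary_row/spectral_weight_unitary.
have w_col B j : \sum_i w B i j = 1.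
  exact/sqnorm_unitary_col/spectral_weight_unitary.
have meanE B i : pdmx B ->
    (spectralmx A *m B *m (spectralmx A)^t*) i i = (mean B i)%:C.
  move=> Bpd; rewrite -[X in _ *m X *m _](mxfun_id (pdmx_herm Bpd)).
  exact: mxfun_form.
have mean0 B i : pdmx B -> 0 < mean B i.
  by move=> Bpd; apply: weighted_mean_gt0 => // j; exact: pdmx_eigenval_gt0.
have trB B : pdmx B -> trfun phi B <= \sum_i phi (mean B i).
  move=> Bpd; rewrite trfunE.
  apply: (@le_trans _ _ (\sum_i \sum_j phi (eigenval B j) * w B i j)).
    rewrite exchange_big /=; apply: ler_sum => j _.
    by rewrite -mulr_sumr w_col mulr1.
  apply: ler_sum => i _; apply: concave_pos_jensen => // j.
  exact: pdmx_eigenval_gt0.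
have le_ev i : t * mean A1 i + (1 - t) * mean A2 i <= eigenval A i.
  have := (psdmx_congr (spectralmx A) leA).2 (delta_mx 0 i).
  rewrite -rowE trmx_delta map_delta_mx -colE [in X in X -> _]mxE mxE.
  rewrite mulmxBr mulmxBl mulmxDr mulmxDl -!scalemxAr -!scalemxAl.
  rewrite (spectralmx_diag (pdmx_herm Apd)).
  rewrite mxE [X in _ + X]mxE [X in _ - X]mxE [X in _ - (X + _)]mxE.
  rewrite [X in _ - (_ + X)]mxE !meanE// 2!mxE eqxx mulr1n.
  by rewrite -!rmorphM -rmorphD -rmorphB /= ler0c subr_ge0.
apply: (@le_trans _ _ (\sum_i (t * phi (mean A1 i) + (1 - t) * phi (mean A2 i)))).
  rewrite big_split /= -[X in _ <= X + _]mulr_sumr -[X in _ <= _ + X]mulr_sumr.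
  by apply: lerD; apply: ler_wpM2l; rewrite ?subr_ge0 ?trB.
rewrite trfunE; apply: ler_sum => i _.
apply: le_trans (phi_nd _ _ _ (le_ev i)); first by apply: phi_c => //; exact: mean0.
by apply: conv_gt0 => //; exact: mean0.
Qed.

(** * The variational formula and its concavity *)

Section Variational.
Variable h : R -> R.
Hypothesis h_concave : concave_pos h.
Hypothesis h_nd : forall x y, 0 < x -> x <= y -> h x <= h y.
Hypothesis h_sublinear : h x * x^-1 @[x --> +oo] --> (0 : R).
Local Notation phi := (conjugate_inv h).

(** [Q] and [Z] need not commute. All three traces expand over pairs of eigenvalues with the same
    doubly stochastic weights [w], so the scalar inequality [h z <= z / u + phi u] applies term by
    term. *)
Lemma trfun_le_conjugate n (Q Z : 'M[C]_n) : pdmx Q -> pdmx Z ->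
  trfun h Z <= complex.Re (\tr (invmx Q *m Z)) + trfun phi Q.
Proof.
move=> Qpd Zpd.
pose w i j := sqnorm ((spectralmx Q *m (spectralmx Z)^t*) i j).
have w0 i j : 0 <= w i j by exact: sqnorm_ge0.
have w_row i : \sum_j w i j = 1.
  exact/sqnorm_unitary_row/spectral_weight_unitary.
have w_col j : \sum_i w i j = 1.
  exact/sqnorm_unitary_col/spectral_weight_unitary.
have -> : complex.Re (\tr (invmx Q *m Z)) =
    \sum_i \sum_j eigenval Z j / eigenval Q i * w i j.
  rewrite -[X in invmx X](mxfun_id (pdmx_herm Qpd)) invmx_mxfun; last first.
    by move=> i; rewrite gt_eqF// pdmx_eigenval_gt0.
  rewrite mxfunE -!mulmxA mxtrace_mulC -mulmxA.
  rewrite /mxtrace Re_sum; apply: eq_bigr => i _.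
  rewrite mul_diag_mx 2!mxE ReZ.
  rewrite -[X in _ *m X *m _](mxfun_id (pdmx_herm Zpd)) mxfun_form /=.
  by rewrite mulr_sumr; apply: eq_bigr => j _; rewrite /w; ring.
have -> : trfun phi Q = \sum_i \sum_j phi (eigenval Q i) * w i j.
  by rewrite trfunE; apply: eq_bigr => i _; rewrite -mulr_sumr w_row mulr1.
rewrite trfunE -big_split /=.
have -> : \sum_i h (eigenval Z i) = \sum_i \sum_j h (eigenval Z j) * w i j.
  rewrite exchange_big /=; apply: eq_bigr => j _.
  by rewrite -mulr_sumr w_col mulr1.
apply: ler_sum => i _; rewrite -big_split /=; apply: ler_sum => j _.
rewrite -mulrDl; apply: ler_wpM2r => //.
by apply: conjugate_inv_ge => //; exact: pdmx_eigenval_gt0.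
Qed.

Definition dual_value n (G X Y : 'M[C]_n) : R :=
  complex.Re (\tr (invmx (G *m G^t*) *m Y)) + trfun phi (G^t* *m X *m G).

(** With [S = sqrtmx X] and [Q = (S G) (S G)'], one has [(G G')^-1 = S Q^-1 S], and cyclicity moves
    the outer [S] around [Y]. The matrices [Q] and [G' X G] are [N N'] and [N' N] for [N = S G],
    hence similar through [N]. *)
Lemma dual_valueE n (G X Y : 'M[C]_n) : G \in unitmx -> pdmx X -> pdmx Y ->
  dual_value G X Y =
    complex.Re (\tr (invmx ((sqrtmx X *m G) *m (sqrtmx X *m G)^t*)
                      *m (sqrtmx X *m Y *m sqrtmx X)))
    + trfun phi ((sqrtmx X *m G) *m (sqrtmx X *m G)^t*).
Proof.
move=> Gu Xpd Ypd; pose S := sqrtmx X; rewrite -/S.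
pose Q := (S *m G) *m (S *m G)^t*; rewrite -/Q.
have Sh : S^t* = S by exact/pdmx_herm/pdmx_sqrt.
have [_ Su] : pdmx S by exact: pdmx_sqrt.
have SS : S *m S = X by exact/sqrtmxM/Xpd.1.
clearbody S.
have Gtu : G^t* \in unitmx by rewrite map_unitmx unitmx_tr.
have QE : Q = S *m (G *m G^t*) *m S by rewrite /Q adjM Sh !mulmxA.
have Hu : G *m G^t* \in unitmx by rewrite unitmx_mul Gu Gtu.
have Qu : Q \in unitmx by rewrite QE !unitmx_mul Su Gu Gtu.
have HE : invmx (G *m G^t*) = S *m invmx Q *m S.
  apply: (can_inj (mulKmx Hu)); rewrite mulmxV//.
  apply: (can_inj (mulKmx Su)).
  by rewrite mulmx1 !mulmxA -[S *m G *m G^t*]mulmxA -QE mulmxV// mul1mx.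
rewrite /dual_value; congr (_ + _).
  by rewrite HE -!mulmxA mxtrace_mulC !mulmxA.
apply/esym/(@trfun_similar _ _ _ _ _ (S *m G)).
- by rewrite /Q !adjM !trmxCK.
- by rewrite !adjM trmxCK (pdmx_herm Xpd) !mulmxA.
- by rewrite unitmx_mul Su Gu.
- by rewrite /Q adjM Sh -SS !mulmxA.
Qed.

Lemma trfun_le_dual_value n (G X Y : 'M[C]_n) :
  G \in unitmx -> pdmx X -> pdmx Y ->
  trfun h (sqrtmx X *m Y *m sqrtmx X) <= dual_value G X Y.
Proof.
move=> Gu Xpd Ypd; rewrite (dual_valueE Gu Xpd Ypd).
have Spd := pdmx_sqrt Xpd.
have SGu : sqrtmx X *m G \in unitmx by rewrite unitmx_mul Spd.2 Gu.
apply: trfun_le_conjugate.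
  by have := pdmx_congr SGu (pdmx1 R n); rewrite mulmx1.
by have := pdmx_congr Spd.2 Ypd; rewrite (pdmx_herm Spd).
Qed.

Lemma dual_value_near n (X Y : 'M[C]_n) (e : R) : 0 < e -> pdmx X -> pdmx Y ->
  exists2 G : 'M[C]_n, G \in unitmx &
    dual_value G X Y <= trfun h (sqrtmx X *m Y *m sqrtmx X) + n%:R * e.
Proof.
move=> e0 Xpd Ypd.
have Spd := pdmx_sqrt Xpd; have Sh := pdmx_herm Spd; have Su := Spd.2.
pose Z := sqrtmx X *m Y *m sqrtmx X.
have Zpd : pdmx Z.
  by have := pdmx_congr Su Ypd; rewrite Sh.
(* The value 0 at [z <= 0] is a filler: the eigenvalues of [Z] are positive. *)
have /choice[u uP] (z : R) :
    exists u, 0 < z -> 0 < u /\ z / u + phi u <= h z + e.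
  case: (ltrP 0 z) => [z0|_]; last by exists 0.
  by have [v v0 vP] := conjugate_inv_near h_nd h_concave z0 e0; exists v.
have u0 i : 0 < u (eigenval Z i) by have [] := uP _ (pdmx_eigenval_gt0 i Zpd).
(* With [G = S^-1 D] the matrix [Q] becomes [D D = u (Z)], which commutes with [Z]. The bound is
   then a sum of scalar ones, losing [e] for each of the [n] eigenvalues. *)
pose D := mxfun (fun z => Num.sqrt (u z)) Z.
have [_ Du] : pdmx D by apply: pdmx_mxfun => i; rewrite sqrtr_gt0.
have DD : D *m D = mxfun u Z.
  rewrite [LHS]mxfunM; apply: eq_mxfun => i.
  by rewrite -expr2 sqr_sqrtr// ltW.
have Gu : invmx (sqrtmx X) *m D \in unitmx by rewrite unitmx_mul unitmx_inv Su Du.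
exists (invmx (sqrtmx X) *m D); first exact: Gu.
rewrite (dual_valueE Gu Xpd Ypd) (mulKVmx Su).
have -> : D^t* = D by exact: mxfun_herm.
rewrite DD -/Z.
have -> : invmx (mxfun u Z) = mxfun (fun z => (u z)^-1) Z.
  by apply: invmx_mxfun => i; rewrite gt_eqF.
have -> : mxfun (fun z => (u z)^-1) Z *m Z = mxfun (fun z => (u z)^-1 * z) Z.
  exact: (mxfun_mulmx _ (pdmx_herm Zpd)).
rewrite -/(trfun (fun z => (u z)^-1 * z) Z) {2}/trfun mxfun_comp -/(trfun _ Z).
rewrite !trfunE -big_split /=.
have -> : n%:R * e = \sum_(i < n) e by rewrite sumr_const card_ord mulr_natl.
rewrite -big_split /=; apply: ler_sum => i _.
by rewrite mulrC; have [] := uP _ (pdmx_eigenval_gt0 i Zpd).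
Qed.

Hypothesis phi_concave : concave_pos phi.

(** [X] and [Y] only dominate the convex combinations, so concavity and monotonicity are used at
    once. The [Y] term is monotone because [(G G')^-1] is a Gram matrix; the [X] term because
    congruence by [G'] preserves the order. *)
Lemma dual_value_concave n (G X X1 X2 Y Y1 Y2 : 'M[C]_n) (t : R) :
  G \in unitmx -> pdmx X -> pdmx X1 -> pdmx X2 -> 0 <= t <= 1 ->
  loewner_le (t%:C *: X1 + (1 - t)%:C *: X2) X ->
  loewner_le (t%:C *: Y1 + (1 - t)%:C *: Y2) Y ->
  t * dual_value G X1 Y1 + (1 - t) * dual_value G X2 Y2 <= dual_value G X Y.
Proof.
move=> Gu Xpd X1pd X2pd t01 leX leY.
have Gtu : G^t* \in unitmx by rewrite map_unitmx unitmx_tr.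
have conjG_pd B : pdmx B -> pdmx (G^t* *m B *m G).
  by move=> Bpd; have := pdmx_congr Gtu Bpd; rewrite trmxCK.
have tr_le : t * trfun phi (G^t* *m X1 *m G) + (1 - t) * trfun phi (G^t* *m X2 *m G)
    <= trfun phi (G^t* *m X *m G).
  apply: (trfun_concave phi_concave (conjugate_inv_nondecreasing h_nd h_sublinear)
    (conjG_pd _ Xpd) (conjG_pd _ X1pd) (conjG_pd _ X2pd) t01).
  have := psdmx_congr (G^t*) leX; rewrite trmxCK mulmxBr mulmxBl.
  by rewrite mulmxDr mulmxDl -!scalemxAr -!scalemxAl.
have HE : invmx (G *m G^t*) = (invmx G)^t* *m invmx G.
  have Hu : G *m G^t* \in unitmx by rewrite unitmx_mul Gu Gtu.
  apply: (can_inj (mulKmx Hu)); rewrite (mulmxV Hu) mulmxA -[X in X *m _]mulmxA.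
  by rewrite -adjM (mulVmx Gu) trmx1 map_mx1 mulmx1 (mulmxV Gu).
have := Re_tr_gram_le (invmx G) leY; rewrite -HE Re_tr_conv.
move: tr_le; rewrite /dual_value => tr_le Y_le.
by rewrite !mulrDr addrACA; exact: lerD Y_le tr_le.
Qed.

(** A [G] nearly optimal for [(X, Y)] is also admissible at both end points, where it gives upper
    bounds. *)
Lemma trfun_sandwich_concave n (X X1 X2 Y Y1 Y2 : 'M[C]_n) (t : R) :
  pdmx X -> pdmx X1 -> pdmx X2 -> pdmx Y -> pdmx Y1 -> pdmx Y2 -> 0 <= t <= 1 ->
  loewner_le (t%:C *: X1 + (1 - t)%:C *: X2) X ->
  loewner_le (t%:C *: Y1 + (1 - t)%:C *: Y2) Y ->
  t * trfun h (sqrtmx X1 *m Y1 *m sqrtmx X1)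
    + (1 - t) * trfun h (sqrtmx X2 *m Y2 *m sqrtmx X2)
  <= trfun h (sqrtmx X *m Y *m sqrtmx X).
Proof.
move=> Xpd X1pd X2pd Ypd Y1pd Y2pd t01 leX leY; have /andP[t0 t1] := t01.
apply/ler_addgt0Pr => e e0.
have n1 : 0 < n.+1%:R :> R by rewrite ltr0n.
(* The loss is [n] times this, at most [e]; the successor covers [n = 0]. *)
have en0 : 0 < e / n.+1%:R by rewrite divr_gt0.
have [G Gu Gle] := dual_value_near en0 Xpd Ypd.
apply: le_trans (_ : dual_value G X Y <= _); last first.
  apply: (le_trans Gle); rewrite lerD2l mulrA ler_pdivrMr// mulrC.
  by apply: ler_wpM2l; [exact: ltW | rewrite ler_nat].
apply: le_trans (dual_value_concave Gu Xpd X1pd X2pd t01 leX leY).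
apply: lerD; apply: ler_wpM2l; first exact: t0.
- exact: trfun_le_dual_value.
- by rewrite subr_ge0.
- exact: trfun_le_dual_value.
Qed.

End Variational.
End TraceFunctions.

(** * Strictly positive linear maps and the final assembly *)

Section PositiveMaps.
Variable R : realType.
Local Open Scope sesquilinear_scope.
Local Notation C := R[i].

(** Needed because a difference of ordered matrices may be singular. [A + e I] is positive definite
    for [e > 0], and [e] tends to 0 along the image of [I]. *)
Lemma strictly_positive_psdmx m k (Phi : {linear 'M[C]_m -> 'M[C]_k}) A :
  strictly_positive Phi -> psdmx A -> psdmx (Phi A).
Proof.
move=> Phi_pos Apsd.
apply: (psdmx_lim (Phi_pos _ (pdmx1 R m)).1) => e /andP[e0 _].
rewrite -linearZ -linearD.
exact: (Phi_pos _ (pdmxD Apsd (pdmxZ e0 (pdmx1 R m)))).1.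
Qed.

Lemma strictly_positive_loewner m k (Phi : {linear 'M[C]_m -> 'M[C]_k}) A B :
  strictly_positive Phi -> loewner_le A B -> loewner_le (Phi A) (Phi B).
Proof.
by move=> Phi_pos AB; rewrite /loewner_le -linearB; exact: strictly_positive_psdmx.
Qed.

Lemma strictly_positive_monotone_concave m k (Phi : {linear 'M[C]_m -> 'M[C]_k})
    (f : R -> R) A1 A2 (t : R) : strictly_positive Phi ->
  (forall x, 0 < x -> 0 < f x) -> operator_monotone f ->
  pdmx A1 -> pdmx A2 -> 0 <= t <= 1 ->
  loewner_le (t%:C *: Phi (mxfun f A1) + (1 - t)%:C *: Phi (mxfun f A2))
             (Phi (mxfun f (t%:C *: A1 + (1 - t)%:C *: A2))).
Proof.
move=> Phi_pos f_pos f_mon A1pd A2pd t01.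
have := strictly_positive_loewner Phi_pos
  (operator_monotone_concave f_pos f_mon A1pd A2pd t01).
by rewrite linearD !linearZ.
Qed.

End PositiveMaps.

Theorem theorem3p6 (R : realType) (h f g : R -> R) (m n k : nat)
    (Phi : {linear 'M[R[i]]_m -> 'M[R[i]]_k})
    (Psi : {linear 'M[R[i]]_n -> 'M[R[i]]_k})
    (h_concave : concave_function `]0, +oo[ h)
    (h_nondecreasing : forall x y : R, 0 < x -> x <= y -> h x <= h y)
    (h_sublinear : h x * x^-1 @[x --> +oo] --> (0 : R))
    (h_legendre : forall x y : R, 0 < x -> 0 < y ->
       (legendre h x + legendre h y) / 2 <= legendre h ((x + y) / 2) /\
       legendre h (2 / (x^-1 + y^-1)) <= (legendre h x + legendre h y) / 2)
    (f_pos : forall x : R, 0 < x -> 0 < f x)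
    (f_monotone : operator_monotone f)
    (g_pos : forall x : R, 0 < x -> 0 < g x)
    (g_monotone : operator_monotone g)
    (Phi_pos : strictly_positive Phi)
    (Psi_pos : strictly_positive Psi) :
  jointly_concave (fun (A : 'M[R[i]]_m) (B : 'M[R[i]]_n) =>
    trfun h (sqrtmx (Phi (mxfun f A)) *m Psi (mxfun g B)
               *m sqrtmx (Phi (mxfun f A)))).
Proof.
have hc := concave_function_pos h_concave.
have phi_c : concave_pos (conjugate_inv h).
  apply: conjugate_inv_concave => // x y x0 y0.
  by have [_] := h_legendre x y x0 y0.
move=> A1 A2 B1 B2 t A1pd A2pd B1pd B2pd t01.
have X_le := strictly_positive_monotone_concave Phi_pos f_pos f_monotone A1pd A2pd t01.
have Y_le := strictly_positive_monotone_concave Psi_pos g_pos g_monotone B1pd B2pd t01.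
have pd_f A : pdmx A -> pdmx (Phi (mxfun f A)).
  by move=> Apd; exact: (Phi_pos _ (pdmx_mxfun_pos f_pos Apd)).
have pd_g B : pdmx B -> pdmx (Psi (mxfun g B)).
  by move=> Bpd; exact: (Psi_pos _ (pdmx_mxfun_pos g_pos Bpd)).
exact: (trfun_sandwich_concave hc h_nondecreasing h_sublinear phi_c
  (pd_f _ (pdmx_conv t01 A1pd A2pd)) (pd_f _ A1pd) (pd_f _ A2pd)
  (pd_g _ (pdmx_conv t01 B1pd B2pd)) (pd_g _ B1pd) (pd_g _ B2pd)
  t01 X_le Y_le).
Qed.
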